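(* Assume that the sequence $(P^{*n}P^n)_{n\in\mathbb{N}}$ associated to the Markov chain $\xi_1,\xi_2,\ldots$ is positive and quasi selfadjoint generated, with constant $q$. Then for all $f\in L_0^2(\pi)$, $$\lim_{n\to\infty}\|P^nf\|_2^{1/n}\ \le\ \max\left(\lim_{n\to\infty}\Bigl(\sqrt{1-k_{P^{*n}P^n}}\Bigr)^{1/n},\ q\right).$$
   Context: Standing assumptions: $\xi_1,\xi_2,\ldots$ is a time-homogeneous, discrete-time, $\pi$-irreducible positive recurrent Markov chain on a state space $(\Omega,\mathcal{F})$ with $\mathcal{F}$ countably generated, transition kernel $p(\cdot,\cdot)$ and unique invariant probability measure $\pi$. The Markov operator is $Pf(x)=\int_\Omega f(y)\,p(x,dy)$ on $L^2(\pi)$ and $P^*$ is its adjoint on $L^2(\pi)$; $P^{*n}P^n$ means $(P^* )^nP^n$. Put $L_0^2(\pi)=\{f\in L^2(\pi):\int f\,d\pi=0\}$ and $L_{0,1}^2(\pi)=\{f\in L_0^2(\pi):\|f\|_2=1\}$. Operators are regarded as acting on $L_0^2(\pi)$. For $A\in\mathcal{F}$ with $0<\pi(A)<1$ (infima over $A$ are over such sets, assumed to exist), put $$k_{P^{*n}P^n}(A)=\frac{1}{\pi(A)\pi(A^c)}\int_A P^{*n}P^n1_{A^c}(x)\,\pi(dx),\qquad k_{P^{*n}P^n}=\inf_A k_{P^{*n}P^n}(A).$$ Definition: a sequence of operators $(A_n)_{n\in\mathbb{N}}$ is called positive and quasi selfadjoint generated if there exist a positive and selfadjoint operator $Q$ and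 constants $C>0$, $q<1$ such that for all step functions $g\in L_{0,1}^2(\pi)$ (that is, $g=\sum_{i=1}^{l}\alpha_i1_{A_i}$ with $A_1,\ldots,A_l\in\mathcal{F}$ pairwise disjoint and $\bigcup_iA_i=\Omega$) one has $\|(A_n-Q^n)g\|_2\le Cq^n$ for all $n\in\mathbb{N}$. The constant $q$ in the claim is the one in this definition.
   Formalization: The limit of ‖P^n f‖_2^{1/n} on the left need not exist for every f in L_0^2(π), so it is replaced by the limit superior; the inequality follows whenever the limit exists. The limit on the right is proved to exist. *)

(* Defs.v *)
From HB Require Import structures.
From mathcomp Require Import all_boot all_order all_algebra.
From mathcomp Require Import all_classical all_reals all_analysis.
Set Implicit Arguments.
Unset Strict Implicit.
Unset Printing Implicit Defensive.
Import Order.TTheory GRing.Theory Num.Theory.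
Import numFieldNormedType.Exports HBSimple.

Local Open Scope classical_set_scope.
Local Open Scope ring_scope.

Definition countably_generated (d : measure_display) (T : measurableType d) :=
  exists2 G : set (set T), countable G & @measurable d T = <<s G >>.

Section Chain.
Context (d : measure_display) (T : measurableType d) (R : realType).
Variable p : R.-pker T ~> T.

Fixpoint kernel_iter (n : nat) (x : T) (A : set T) : \bar R :=
  if n is m.+1 then (\int[p x]_y kernel_iter m y A)%E else \d_x A.

Definition invariant (mu : probability T R) :=
  forall A, measurable A -> (\int[mu]_x p x A)%E = mu A.

Definition irreducible (mu : probability T R) :=
  forall A, measurable A -> (0 < mu A)%E ->
  forall x, exists n, (0 < kernel_iter n.+1 x A)%E.

(* Recurrence in the sense of Meyn and Tweedie: infinite expected number of
   visits. The measure mu is the irreducibility measure. *)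
Definition recurrent (mu : probability T R) :=
  forall A, measurable A -> (0 < mu A)%E ->
  forall x, (\sum_(1 <= n <oo) kernel_iter n x A = +oo)%E.

(* An irreducible recurrent chain is positive when it has an invariant
   probability measure. *)
Definition positive_recurrent (mu : probability T R) :=
  [/\ irreducible mu, recurrent mu, invariant mu &
   forall nu : probability T R, invariant nu ->
     forall A, measurable A -> nu A = mu A].

(* If f is square integrable for an invariant measure, the integral is finite
   for almost every x; on the exceptional null set Rintegral is still a real
   number, so that markov_op p can be iterated on functions. *)
Definition markov_op (f : T -> R) : T -> R := fun x => \int[p x]_y f y.

End Chain.

(* L^2(mu) is represented by its representatives, i.e. functions f : T -> R with
   f \in Lfun mu 2%:E, and an operator by a map (T -> R) -> (T -> R) whose
   values only matter up to mu-almost everywhere equality. *)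
Section L2.
Context (d : measure_display) (T : measurableType d) (R : realType).
Variable mu : probability T R.
Implicit Types (f g : T -> R) (A Q : (T -> R) -> (T -> R)).

Definition L2 : set (T -> R) := [set f | f \in Lfun mu 2%:E].

Definition L20 : set (T -> R) := [set f | L2 f /\ \int[mu]_x f x = 0].

Definition norm2 f : \bar R := 'N[mu]_2%:E[EFin \o f].

Definition inner f g : R := \int[mu]_x (f x * g x).

(* Additivity, boundedness and compatibility with a.e. equality follow from the
   adjoint identity for everywhere defined maps. *)
Definition is_adjoint A B :=
  (forall f, L2 f -> L2 (B f)) /\
  (forall f g, L2 f -> L2 g -> inner (A f) g = inner f (B g)).

Record bounded_operator_on (V : set (T -> R)) A : Prop := {
  op_stable : forall f, V f -> V (A f);
  op_ae : forall f g, V f -> V g -> f = g %[ae mu] -> A f = A g %[ae mu];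
  op_linear : forall (a : R) f g, V f -> V g ->
    A (a \*: f \+ g) = a \*: A f \+ A g %[ae mu];
  op_bounded : exists M : R, forall f, V f -> (norm2 (A f) <= M%:E * norm2 f)%E
}.

Record positive_selfadjoint_on (V : set (T -> R)) Q : Prop := {
  psa_operator : bounded_operator_on V Q;
  psa_selfadjoint : forall f g, V f -> V g -> inner (Q f) g = inner f (Q g);
  psa_positive : forall f, V f -> 0 <= inner (Q f) f
}.

Definition positive_quasi_selfadjoint_generated
    (A : nat -> (T -> R) -> (T -> R)) (q : R) :=
  q < 1 /\
  exists Q : (T -> R) -> (T -> R), exists C : R,
    [/\ positive_selfadjoint_on L20 Q, 0 < C &
     forall g : {sfun T >-> R}, L20 g -> norm2 g = 1%E ->
     forall n, (norm2 (A n g \- iter n Q g)%R <= (C * q ^+ n)%:E)%E].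

Definition nontrivial_set : set (set T) :=
  [set S | measurable S /\ (0 < mu S < 1)%E].

Definition kset A (S : set T) : R :=
  (fine (mu S) * fine (mu (~` S)))^-1 * \int[mu]_(x in S) A (\1_(~` S)) x.

Definition kinf A : R := inf [set kset A S | S in nontrivial_set].

End L2.

(* Main.v *)
(** For each [n], the covariance form [<P^n f, P^n g> - (\int f) (\int g)]
    satisfies [cov 1_A 1_A <= s pi(A) pi(A^c)] with best constant
    [s = 1 - k_{P^*n P^n}], and [cov 1_A 1_B <= min (pi A) (pi B)] because [P] is
    Markov and preserves [pi]. Expand [f >= 0] in binary as [\sum_j 2^j 1_{D_j}]:
    the pairs [(i, j)] with [|i - j| < N] contribute at most [N s ||f||^2] and the
    others at most a multiple of [2^-N ||f||^2]. Hence
    [s <= ||P^n||^2 <= 32 (N s + 2^-N)] on [L^2_0] for every [N], so testing on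
    indicators only loses a factor logarithmic in [s]. Therefore
    [(sqrt (1 - k_{P^*n P^n}))^{1/n}] converges to the spectral radius
    [lim ||P^n||^{1/n}] of [P] on [L^2_0], which bounds [||P^n f||^{1/n}]. *)

Require Import Defs.
From HB Require Import structures.
From mathcomp Require Import all_boot all_order all_algebra.
From mathcomp Require Import all_classical all_reals all_analysis.
From mathcomp Require Import measurable_realfun ring lra zify.
Import Order.TTheory GRing.Theory Num.Theory.
Import numFieldNormedType.Exports.
Local Open Scope classical_set_scope.
Local Open Scope ring_scope.

(** * Real sequences: n-th roots, geometric domination and submultiplicative growth rates *)

Section NthRoots.
Context {R : realType}.
Implicit Types (x y s C : R) (n m : nat).

Lemma powR_invnK n s : (0 < n)%N -> 0 <= s -> (s `^ n%:R^-1) ^+ n = s.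
Proof.
move=> n0 s0; rewrite -powR_mulrn ?powR_ge0// -powRrM mulVf ?powRr1//.
by rewrite pnatr_eq0 -lt0n.
Qed.

Lemma powR_invn_le n s y : (0 < n)%N -> 0 <= s -> 0 <= y ->
  (s `^ n%:R^-1 <= y) = (s <= y ^+ n).
Proof.
move=> n0 s0 y0; rewrite -[in RHS](powR_invnK _ _ n0 s0).
by rewrite ler_pXn2r// nnegrE// powR_ge0.
Qed.

Lemma powR_invn_ge n s y : (0 < n)%N -> 0 <= s -> 0 <= y ->
  (y <= s `^ n%:R^-1) = (y ^+ n <= s).
Proof.
move=> n0 s0 y0; rewrite -[in RHS](powR_invnK _ _ n0 s0).
by rewrite ler_pXn2r// nnegrE// powR_ge0.
Qed.

(** The ratio $(x/y)^n$ tends to 0, so it eventually drops below the inverse of [|C| + 1], which is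
    positive whatever the sign of [C]. This absorbs constants into a slightly larger base. *)
Lemma expr_dominated C x y : 0 <= x -> x < y ->
  \forall n \near \oo, C * x ^+ n <= y ^+ n.
Proof.
move=> x0 xy; have y0 : 0 < y by apply: le_lt_trans xy.
have C0 : 0 < `|C| + 1 by rewrite ltr_wpDl.
have z0 : 0 <= x / y by rewrite divr_ge0// ltW.
have /cvgrPdist_lt /(_ (`|C| + 1)^-1) : (fun n => (x / y) ^+ n) @ \oo --> (0 : R).
  by apply: cvg_expr; rewrite ger0_norm// ltr_pdivrMr// mul1r.
rewrite invr_gt0 => /(_ C0); apply: filterS => n.
rewrite sub0r normrN ger0_norm ?exprn_ge0// expr_div_n.
rewrite ltr_pdivrMr ?exprn_gt0// mulrC ltr_pdivlMr// => /ltW h.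
apply: le_trans h; rewrite mulrC ler_wpM2l ?exprn_ge0//.
by rewrite (le_trans (ler_norm C))// lerDl.
Qed.

(** With [w] the midpoint of [x] and [y], passing from [x] to [w] absorbs the constant [C / t], and
    Bernoulli's inequality $n t \le (1+t)^n = (y/w)^n$ absorbs the factor [n]. *)
Lemma natr_expr_dominated C x y : 0 <= x -> x < y ->
  \forall n \near \oo, C * n%:R * x ^+ n <= y ^+ n.
Proof.
move=> x0 xy; pose w := (x + y) / 2; pose t := y / w - 1.
have w0 : 0 < w by rewrite /w; lra.
have t0 : 0 < t by rewrite /t subr_gt0 ltr_pdivlMr// mul1r /w; lra.
have xw : x < w by rewrite /w; lra.
near=> n.
have h1 : C / t * x ^+ n <= w ^+ n by near: n; exact: expr_dominated.
have h2 : n%:R * t <= (y / w) ^+ n.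
  have -> : y / w = 1 + t by rewrite /t addrC subrK.
  elim: (n) => [|k IH]; first by rewrite mul0r expr0.
  have p1 : 1 <= (1 + t) ^+ k by rewrite exprn_ege1// lerDl ltW.
  rewrite exprS mulrDl mul1r -natr1 mulrDl mul1r lerD//.
  by rewrite ler_peMr// ltW.
have -> : y ^+ n = (y / w) ^+ n * w ^+ n by rewrite -exprMn divfK// gt_eqF.
apply: (@le_trans _ _ (n%:R * t * w ^+ n)); last by rewrite ler_wpM2r// exprn_ge0// ltW.
apply: (@le_trans _ _ (n%:R * t * (C / t * x ^+ n))).
  by rewrite le_eqVlt; apply/orP; left; apply/eqP; field; rewrite gt_eqF.
by rewrite ler_wpM2l// mulr_ge0// ltW.
Unshelve. all: by end_near. Qed.

(** Peeling off blocks of length [m] costs [x ^+ m] each and leaves a remainder [b < m], where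
    [L b <= 1]; the sum of all [x ^- b] serves as a constant for every remainder at once. *)
Lemma submultiplicative_expr_bound (L : nat -> R) m x :
    (forall n, 0 <= L n <= 1) -> (forall i j, L (i + j)%N <= L i * L j) ->
    (0 < m)%N -> 0 < x -> L m <= x ^+ m ->
  exists C, forall n, L n <= C * x ^+ n.
Proof.
move=> L01 LM m0 x0 Lm; pose C : R := \sum_(b < m) (x ^+ b)^-1.
have C0 : 0 <= C by rewrite sumr_ge0// => i _; rewrite invr_ge0 exprn_ge0// ltW.
exists C => n; elim/ltn_ind: n => n IH; have [nm|mn] := ltnP n m.
  have [_ /le_trans] := andP (L01 n); apply.
  rewrite -ler_pdivrMr ?exprn_gt0// mul1r /C (bigD1 (Ordinal nm))//= lerDl.
  by rewrite sumr_ge0// => i _; rewrite invr_ge0 exprn_ge0// ltW.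
rewrite -(subnKC mn) (le_trans (LM _ _))// exprD mulrCA.
apply: ler_pM; rewrite ?(andP (L01 _)).1//.
by apply: IH; rewrite ltn_subrL m0 (leq_trans m0 mn).
Qed.

(* With [r] the limit of [L n `^ n^-1], taking [N] proportional to [n] makes the
   error [2^-N] negligible against [L n >= r ^+ n], so [S n] decays no faster
   than [r ^+ n / n]. *)
Lemma cvg_root_of_log_comparable (L S : nat -> R) (a : R) :
    (forall n, 0 <= L n <= 1) -> (forall i j, L (i + j)%N <= L i * L j) ->
    (forall n, 0 <= S n <= L n) -> 0 <= a ->
    (forall n N, L n <= a * (N%:R * S n + 2^-1 ^+ N)) ->
  exists rho : R, [/\ 0 <= rho,
    (fun n => Num.sqrt (S n) `^ n%:R^-1) @ \oo --> rho &
    forall y, rho < y -> exists C, forall n, L n <= C * (y ^+ 2) ^+ n].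
Proof.
move=> L01 LM SL a0 LS.
have L0 n : 0 <= L n by case/andP: (L01 n).
have S0 n : 0 <= S n by case/andP: (SL n).
(* As in Fekete's lemma, the limit of the roots is their infimum over [n > 0]. *)
pose E := [set L n `^ n%:R^-1 | n in [set n | (0 < n)%N]].
have hE : has_inf E.
  split; first by exists (L 1%N `^ 1%:R^-1), 1%N.
  by exists 0 => _ [n _ <-]; exact: powR_ge0.
have r0 : 0 <= inf E by apply: lb_le_inf hE.1 _ => _ [n _ <-]; exact: powR_ge0.
have rL n : (0 < n)%N -> inf E ^+ n <= L n.
  by move=> n0; rewrite -powR_invn_ge//; apply: (ge_inf hE.2); exists n.
have Lr x : inf E < x -> exists C, forall n, L n <= C * x ^+ n.
  move=> rx; have [_ [m m0 <-] mx] := inf_lt hE.1 rx.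
  have x0 : 0 < x by exact: le_lt_trans rx.
  apply: (submultiplicative_expr_bound _ m) => //.
  by rewrite -powR_invn_le// ltW.
exists (Num.sqrt (inf E)); split; first exact: sqrtr_ge0.
- have lower y : 0 <= y -> y < Num.sqrt (inf E) ->
      \forall n \near \oo, y <= Num.sqrt (S n) `^ n%:R^-1.
    move=> y0 yr; have yr2 : y ^+ 2 < inf E.
      by rewrite -[ltRHS]sqr_sqrtr// ltr_pXn2r// nnegrE sqrtr_ge0.
    have rpos : 0 < inf E by apply: le_lt_trans yr2; exact: sqr_ge0.
    (* With this [M], the choice $N = M n$ makes $2^{-N}$ geometrically smaller than
       [inf E ^+ n]. *)
    have [M hM] : exists M, 2^-1 ^+ M < inf E.
      have /filter_ex [M] : \forall M \near \oo, 2 / inf E * 2^-1 ^+ M <= 1 ^+ M.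
        by apply: expr_dominated; lra.
      rewrite expr1n mulrAC ler_pdivrMr// mul1r => hM; exists M.
      have : 0 < 2^-1 ^+ M :> R by rewrite exprn_gt0// invr_gt0.
      by lra.
    near=> n; have n0 : (0 < n)%N by near: n; exists 1%N.
    rewrite powR_invn_ge ?sqrtr_ge0// -[leLHS]ger0_norm ?exprn_ge0// -sqrtr_sqr.
    apply: ler_wsqrtr; rewrite -exprM mulnC exprM.
    have h1 : 2 * a * (2^-1 ^+ M) ^+ n <= inf E ^+ n.
      by near: n; apply: expr_dominated hM; rewrite exprn_ge0// invr_ge0.
    (* Half of [inf E ^+ n] pays for the $2^{-N}$ term, which leaves
       [inf E ^+ n <= 2 * a * M * n * S n]. The added 1 keeps [c] positive even if [a] or [M]
       vanishes. *)
    pose c := 2 * a * M%:R + 1.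
    have h2 : c * n%:R * (y ^+ 2) ^+ n <= inf E ^+ n.
      by near: n; apply: natr_expr_dominated yr2; exact: sqr_ge0.
    have c0 : 0 < c * n%:R.
      by rewrite mulr_gt0 ?ltr0n// /c ltr_wpDl// !mulr_ge0.
    rewrite -(ler_pM2l c0); apply: le_trans h2 _.
    have := LS n (M * n)%N; rewrite exprM natrM => h3.
    have := rL n n0; have : 0 <= n%:R * S n by rewrite mulr_ge0.
    by rewrite /c; nra.
  have upper y : Num.sqrt (inf E) < y ->
      \forall n \near \oo, Num.sqrt (S n) `^ n%:R^-1 <= y.
    move=> yr; have y0 : 0 < y by apply: le_lt_trans yr; exact: sqrtr_ge0.
    have yr2 : inf E < y ^+ 2.
      by rewrite -(sqr_sqrtr r0) ltr_pXn2r// nnegrE ?sqrtr_ge0// ltW.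
    have [x rx xy] : exists2 x, inf E < x & x < y ^+ 2.
      by exists ((inf E + y ^+ 2) / 2); lra.
    have [C hC] := Lr x rx.
    near=> n; have n0 : (0 < n)%N by near: n; exists 1%N.
    rewrite powR_invn_le ?sqrtr_ge0 ?(ltW y0)//.
    rewrite -[leRHS]ger0_norm ?exprn_ge0 ?(ltW y0)// -sqrtr_sqr.
    apply: ler_wsqrtr; rewrite -exprM mulnC exprM.
    have [_ /le_trans] := andP (SL n); apply; apply: le_trans (hC n) _.
    by near: n; apply: expr_dominated xy; exact: le_trans (ltW rx).
  apply/cvgrPdist_le => e e0.
  have lowere : \forall n \near \oo,
      Num.sqrt (inf E) - e <= Num.sqrt (S n) `^ n%:R^-1.
    (* [lower] requires a nonnegative bound; a negative one is trivially below a root. *)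
    have [h|h] := ltP (Num.sqrt (inf E) - e) 0.
      by apply: nearW => n; rewrite (le_trans (ltW h))// powR_ge0.
    by apply: lower => //; rewrite ltrBlDr ltrDl.
  near=> n.
  have h1 : Num.sqrt (S n) `^ n%:R^-1 <= Num.sqrt (inf E) + e.
    by near: n; apply: upper; rewrite ltrDl.
  have h2 : Num.sqrt (inf E) - e <= Num.sqrt (S n) `^ n%:R^-1 by near: n.
  by rewrite ler_norml; apply/andP; split; lra.
- move=> y yr; apply: Lr; rewrite -(sqr_sqrtr r0).
  have s0 := sqrtr_ge0 (inf E).
  by rewrite ltr_pXn2r// nnegrE// ltW// (le_lt_trans s0).
Unshelve. all: by end_near. Qed.
End NthRoots.

(** * Square integrable functions and their inner product, at the level of representatives *)

Section SquareIntegrable.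
Context {d : measure_display} {T : measurableType d} {R : realType}
  (mu : probability T R).
Implicit Types (f g h : T -> R) (a b : R) (A : set T).

Lemma L2_measurable {f} : L2 mu f -> measurable_fun setT f.
Proof. by rewrite /L2/= inE => /andP[/[!inE]]. Qed.

Lemma L2P f : L2 mu f <->
  measurable_fun setT f /\ (\int[mu]_x (f x ^+ 2)%:E < +oo)%E.
Proof.
split=> [f2|[mf f2]].
  split; first exact: L2_measurable.
  have /integrableP[_] := Lfun2_integrable_sqr f2.
  by under eq_integral do rewrite gee0_abs ?lee_fin ?sqr_ge0//.
rewrite /L2/= inE; apply/andP; split; rewrite inE//=.
rewrite /finite_norm unlock poweR_lty//.
by under eq_integral do rewrite /= powR_mulrn// real_normK ?num_real//.
Qed.

Lemma L2_cst a : L2 mu (cst a). Proof. exact: Lfun_cst. Qed.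

Let le12 : (1 <= 2%:E :> \bar R)%E. Proof. by rewrite lee1n. Qed.

Lemma L2DZ a {f g} : L2 mu f -> L2 mu g -> L2 mu (fun x => a * f x + g x).
Proof. exact: (Lfun_submod_closed mu le12).2. Qed.

Lemma L2D {f g} : L2 mu f -> L2 mu g -> L2 mu (fun x => f x + g x).
Proof.
by move=> f2 /(L2DZ 1 f2); under eq_fun do rewrite mul1r.
Qed.

Lemma L2Z a {f} : L2 mu f -> L2 mu (fun x => a * f x).
Proof.
by move=> f2; have := L2DZ a f2 (L2_cst 0); under eq_fun do rewrite addr0.
Qed.

Lemma L2B {f g} : L2 mu f -> L2 mu g -> L2 mu (fun x => f x - g x).
Proof.
move=> f2 g2; have := L2DZ (- 1) g2 f2.
by under eq_fun do rewrite mulN1r addrC.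
Qed.

Lemma L2_sum (I : Type) (r : seq I) (F : I -> T -> R) :
  (forall i, L2 mu (F i)) -> L2 mu (fun x => \sum_(i <- r) F i x).
Proof.
move=> F2; elim: r => [|i r IH].
  by under eq_fun do rewrite big_nil; exact: L2_cst.
by under eq_fun do rewrite big_cons; exact: L2D.
Qed.

Lemma L2_le {f g} : measurable_fun setT f -> L2 mu g ->
  (forall x, `|f x| <= `|g x|) -> L2 mu f.
Proof.
move=> mf /L2P[mg g2] fg; apply/L2P; split=> //.
apply: le_lt_trans g2; apply: ge0_le_integral => //.
all: try by move=> x _; rewrite lee_fin sqr_ge0.
all: try by apply/measurable_EFinP; exact: measurable_funX.
move=> x _; rewrite lee_fin -(real_normK (num_real (f x))).
by rewrite -(real_normK (num_real (g x))) ler_pXn2r// nnegrE.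
Qed.

Lemma L2_bounded {f} a : measurable_fun setT f ->
  (forall x, `|f x| <= a) -> L2 mu f.
Proof.
move=> mf fa; apply: (L2_le mf (L2_cst a)) => x /=.
by rewrite (le_trans (fa x))// ler_norm.
Qed.

Lemma L2_indic {A} : measurable A -> L2 mu \1_A.
Proof.
move=> mA; apply: (L2_bounded 1); first exact: measurable_indic.
by move=> x; rewrite indicE; case: (_ \in _); rewrite ?normr1// normr0.
Qed.

Lemma L2_mul_integrable {f g} : L2 mu f -> L2 mu g ->
  mu.-integrable setT (EFin \o (fun x => f x * g x)).
Proof. by move=> f2 g2; apply/Lfun1_integrable; exact: Lfun2_mul_Lfun1. Qed.

Lemma L2_integrable {f} : L2 mu f -> mu.-integrable setT (EFin \o f).
Proof.
move=> f2; have := L2_mul_integrable f2 (L2_cst 1).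
by apply: eq_integrable => // x _; rewrite /= mulr1.
Qed.

Lemma innerC f g : inner mu f g = inner mu g f.
Proof. by apply: eq_Rintegral => x _; rewrite mulrC. Qed.

Lemma innerDl {f g h} : L2 mu f -> L2 mu g -> L2 mu h ->
  inner mu (fun x => f x + g x) h = inner mu f h + inner mu g h.
Proof.
move=> f2 g2 h2; rewrite /inner -RintegralD//; try exact: L2_mul_integrable.
by apply: eq_Rintegral => x _; rewrite mulrDl.
Qed.

Lemma innerZl a {f g} : L2 mu f -> L2 mu g ->
  inner mu (fun x => a * f x) g = a * inner mu f g.
Proof.
move=> f2 g2; rewrite /inner -RintegralZl//; last exact: L2_mul_integrable.
by apply: eq_Rintegral => x _; rewrite mulrA.
Qed.

Lemma inner_suml (I : Type) (r : seq I) (F : I -> T -> R) g :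
    (forall i, L2 mu (F i)) -> L2 mu g ->
  inner mu (fun x => \sum_(i <- r) F i x) g = \sum_(i <- r) inner mu (F i) g.
Proof.
move=> F2 g2; elim: r => [|i r IH].
  rewrite big_nil; under [LHS]eq_Rintegral do rewrite big_nil mul0r.
  by rewrite Rintegral_cst// mul0r.
rewrite big_cons -IH -innerDl//; last exact: L2_sum.
by apply: eq_Rintegral => x _; rewrite big_cons.
Qed.

Lemma inner_ge0 f : 0 <= inner mu f f.
Proof. by apply: Rintegral_ge0 => x _; rewrite -expr2 sqr_ge0. Qed.

Lemma Rintegral_cst1 : \int[mu]_x cst 1 x = 1 :> R.
Proof.
rewrite Rintegral_cst// mul1r -[RHS]/(fine 1%E); congr fine.
exact: probability_setT.
Qed.

Lemma inner1r f : inner mu f (cst 1) = \int[mu]_x f x.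
Proof. by apply: eq_Rintegral => x _; rewrite mulr1. Qed.

Lemma le_inner {f g h k} : L2 mu f -> L2 mu g -> L2 mu h -> L2 mu k ->
  (forall x, f x * g x <= h x * k x) -> inner mu f g <= inner mu h k.
Proof.
by move=> *; apply: le_Rintegral => //; exact: L2_mul_integrable.
Qed.

Lemma Rintegral_indic A : measurable A -> \int[mu]_x \1_A x = fine (mu A).
Proof. by move=> mA; rewrite /Rintegral integral_indic// setIT. Qed.

Lemma inner_indic A : measurable A -> inner mu \1_A \1_A = fine (mu A).
Proof.
move=> mA; rewrite -Rintegral_indic//; apply: eq_Rintegral => x _.
by rewrite indicE; case: (_ \in _); rewrite ?mulr1 ?mulr0.
Qed.

Lemma inner_EFin f : L2 mu f ->
  (\int[mu]_x (f x ^+ 2)%:E)%E = (inner mu f f)%:E.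
Proof.
move=> f2; rewrite /inner /Rintegral fineK.
  by apply: eq_integral => x _; rewrite expr2.
by apply: integrable_fin_num => //; exact: L2_mul_integrable.
Qed.

Lemma norm2E f : L2 mu f -> norm2 mu f = (Num.sqrt (inner mu f f))%:E.
Proof.
move=> f2; rewrite /norm2 unlock -powR12_sqrt ?inner_ge0// -poweR_EFin.
rewrite -inner_EFin//; congr (_ `^ _)%E; apply: eq_integral => x _.
by rewrite /= powR_mulrn// real_normK ?num_real.
Qed.

Lemma inner_sqrDZ a f g : L2 mu f -> L2 mu g ->
  inner mu (fun x => f x + a * g x) (fun x => f x + a * g x) =
  inner mu f f + 2 * a * inner mu f g + a ^+ 2 * inner mu g g.
Proof.
move=> f2 g2; have ag2 := L2Z a g2; have h2 := L2D f2 ag2.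
rewrite innerDl// innerZl// !(innerC _ (fun x => _ + _)) !innerDl// !innerZl//.
by rewrite (innerC g f); ring.
Qed.

(** The variance is nonnegative: expand the squared norm of [f] minus its mean. *)
Lemma sqr_Rintegral_le f : L2 mu f -> (\int[mu]_x f x) ^+ 2 <= inner mu f f.
Proof.
move=> f2; have := inner_ge0 (fun x => f x + (- \int[mu]_x f x) * cst 1 x).
rewrite inner_sqrDZ//; last exact: L2_cst.
by rewrite !inner1r Rintegral_cst1; nra.
Qed.
End SquareIntegrable.

(** * Weights depending on the distance between binary levels, and binary digits *)

Section DyadicWeights.
Context {R : realType}.
Implicit Types (s : R) (w : nat -> R).

(** Bound for the covariance of two levels at distance [k], relative to the sum of their squared
    norms: the indicator bound [s] near the diagonal, halved by the arithmetic-geometric mean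
    inequality, and geometric decay from distance [N] on. *)
Definition dyadic_weight (N : nat) s (k : nat) : R :=
  if (k < N)%N then s / 2 else 2^-1 ^+ k.

Lemma dyadic_weight_ge0 N s k : 0 <= s -> 0 <= dyadic_weight N s k.
Proof. by move=> s0; rewrite /dyadic_weight; case: ifP; rewrite ?divr_ge0// exprn_ge0. Qed.

Lemma sum_dyadic_weight_le N s n : 0 <= s ->
  \sum_(0 <= k < n) dyadic_weight N s k <= N%:R * (s / 2) + 2 * 2^-1 ^+ N.
Proof.
(* This sharper bound is the induction invariant: the first term grows only while [n < N], the
   geometric tail only afterwards. *)
move=> s0; apply: (@le_trans _ _ ((minn n N)%:R * (s / 2) +
  2 * (2^-1 ^+ N - 2^-1 ^+ maxn n N))); last first.
  apply: lerD; first by rewrite ler_wpM2r ?divr_ge0// ler_nat geq_minr.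
  by rewrite ler_wpM2l// gerBl exprn_ge0.
elim: n => [|n IH]; first by rewrite big_nil min0n max0n subrr mul0r mulr0 addr0.
rewrite big_nat_recr//= (le_trans (lerD IH (lexx _)))// /dyadic_weight.
have [nN|Nn] := ltnP n N.
  by rewrite (minn_idPl nN) (maxn_idPr nN) -natr1; lra.
by rewrite (minn_idPr (leqW Nn)) (maxn_idPl (leqW Nn)) exprS; lra.
Qed.

(** With truncated subtraction the argument of [w] is $|i-j|$. Every distance occurs at most once on
    each side of [i], whence the factor 2. *)
Lemma sum_distn_le w W m i : (forall k, 0 <= w k) ->
    (forall n, \sum_(0 <= k < n) w k <= W) -> (i < m)%N ->
  \sum_(0 <= j < m) w ((i - j) + (j - i))%N <= 2 * W.
Proof.
move=> w0 hW im; rewrite (big_cat_nat _ (ltnW im))//= mulr2n mulrDl mul1r lerD//.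
  rewrite big_nat_rev/= add0n; apply: le_trans (hW i.+1).
  rewrite [leRHS]big_nat_recl//= [leRHS]addrC ler_wpDr//.
  rewrite [leLHS]big_nat_cond [leRHS]big_nat_cond ler_sum// => j ji.
  by rewrite le_eqVlt; apply/orP; left; apply/eqP; congr w; lia.
apply: le_trans (hW (m - i)%N).
rewrite -{1}(add0n i) big_addn le_eqVlt; apply/orP; left; apply/eqP.
by apply: eq_bigr => j _; congr w; lia.
Qed.

Lemma sum_bits (k m : nat) :
  (\sum_(0 <= j < m) 2 ^ j * odd (k %/ 2 ^ j))%N = (k %% 2 ^ m)%N.
Proof.
elim: m => [|m IH]; first by rewrite big_nil modn1.
rewrite big_nat_recr//= IH.
have rlt : (k %% 2 ^ m < 2 ^ m)%N by rewrite ltn_pmod ?expn_gt0.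
(* Split [k] into the digits above position [m], the digit at [m] and the digits below; the last two
   parts make a number less than $2^{m+1}$. *)
have e : k = ((k %/ 2 ^ m)./2 * 2 ^ m.+1 + (k %% 2 ^ m + 2 ^ m * odd (k %/ 2 ^ m)))%N.
  rewrite {1}(divn_eq k (2 ^ m)) -{1}(odd_double_half (k %/ 2 ^ m)) -muln2 expnS.
  by ring.
rewrite [in RHS]e modnMDl [RHS]modn_small//.
by rewrite expnS; case: odd; rewrite /= ?muln1 ?muln0; lia.
Qed.
End DyadicWeights.

(** * Binary expansion of nonnegative square integrable functions *)

Section DyadicApproximation.
Context {d : measure_display} {T : measurableType d} {R : realType}
  (mu : probability T R).
Implicit Types (f g : T -> R).

Definition dyadic_sum (D : nat -> set T) (m : nat) (x : T) : R :=
  \sum_(0 <= j < m) 2 ^+ j * \1_(D j) x.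

Lemma dyadic_sum_ge0 D m x : 0 <= dyadic_sum D m x.
Proof. by rewrite sumr_ge0// => j _; rewrite mulr_ge0// exprn_ge0. Qed.

Lemma L2_dyadic_sum D m : (forall j, measurable (D j)) -> L2 mu (dyadic_sum D m).
Proof. by move=> mD; apply: L2_sum => j; apply/L2Z/L2_indic. Qed.

Definition bit_set (h : T -> nat) (j : nat) : set T :=
  [set x | odd (h x %/ 2 ^ j)].

Lemma dyadic_sum_bit_set (h : T -> nat) m x :
  dyadic_sum (bit_set h) m x = (h x %% 2 ^ m)%:R.
Proof.
rewrite /dyadic_sum -sum_bits natr_sum; apply: eq_bigr => j _.
rewrite natrM natrX indicE; congr (_ * _%:R); congr nat_of_bool.
by apply/idP/idP; rewrite inE.
Qed.

(** The truncation takes countably many values, each on the preimage of an interval $[k, k+1)$. *)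
Lemma measurable_bit_set f n j : measurable_fun setT f -> (forall x, 0 <= f x) ->
  measurable (bit_set (fun x => Num.truncn (2 ^+ n * f x)) j).
Proof.
move=> mf f0.
have -> : bit_set (fun x => Num.truncn (2 ^+ n * f x)) j =
    \bigcup_(k in [set k : nat | odd (k %/ 2 ^ j)])
      (fun x => 2 ^+ n * f x) @^-1` `[k%:R, k.+1%:R[%classic.
  apply/seteqP; split=> x /=.
    move=> hx; exists (Num.truncn (2 ^+ n * f x)) => //=.
    by rewrite in_itv/= truncn_itv// mulr_ge0// exprn_ge0.
  by move=> [k /= hk]; rewrite in_itv/= /bit_set/= => /truncn_def ->.
apply: bigcup_measurable => k _; rewrite -[X in measurable X]setTI.
by have : measurable_fun setT (fun x => 2 ^+ n * f x); [exact: measurable_funM|exact].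
Qed.

(** Truncate $2^n f$ to an integer, keep its lowest $2n$ bits and rescale by $a = 2^{-n}$. The
    result never exceeds [f] and is within $2^{-n}$ of it wherever $f < 2^n$, hence eventually at
    each point. Dominated convergence with majorant $f^2$ gives convergence in $L^2$. *)
Lemma dyadic_approximation f e : L2 mu f -> (forall x, 0 <= f x) -> 0 < e ->
  exists D m a, [/\ forall j, measurable (D j), 0 <= a,
    forall x, a * dyadic_sum D m x <= f x &
    inner mu (fun x => f x - a * dyadic_sum D m x)
             (fun x => f x - a * dyadic_sum D m x) <= e].
Proof.
move=> f2 f0 e0; pose D n := bit_set (fun x => Num.truncn (2 ^+ n * f x)).
pose g n x := 2 ^- n * dyadic_sum (D n) (n + n) x.
have mD n j : measurable (D n j) by apply: measurable_bit_set => //; exact: L2_measurable f2.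
have p0 n : 0 < 2 ^+ n :> R by rewrite exprn_gt0.
have g0 n x : 0 <= g n x by rewrite mulr_ge0 ?dyadic_sum_ge0// invr_ge0 ltW.
have gf n x : g n x <= f x.
  rewrite /g dyadic_sum_bit_set ler_pdivrMl//.
  have /truncn_itv/andP[h _] : 0 <= 2 ^+ n * f x by rewrite mulr_ge0// ltW.
  by apply: le_trans h; rewrite ler_nat leq_mod.
have g2 n : L2 mu (g n) by apply/L2Z/L2_dyadic_sum.
have fgn n x : f x < 2 ^+ n -> f x - g n x <= 2^-1 ^+ n.
  move=> fn; rewrite /g dyadic_sum_bit_set modn_small; last first.
    rewrite truncn_lt_nat ?natrX ?exprD ?ltr_pM2l//.
    by rewrite mulr_ge0// ltW.
  have /truncn_itv/andP[_ h] : 0 <= 2 ^+ n * f x by rewrite mulr_ge0// ltW.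
  rewrite exprVn -(ler_pM2l (p0 n)) mulrBr !mulrA divff ?gt_eqF// mul1r.
  by rewrite lerBlDl natr1 ltW.
pose r n x := f x - g n x.
have r2 n : L2 mu (r n) by exact: L2B.
have cvg0 x : (r n x ^+ 2)%:E @[n --> \oo] --> 0%:E.
  apply/cvg_EFin; first exact: nearW.
  apply: (squeeze_cvgr (f := cst 0) (h := fun n => 2^-1 ^+ n)).
  - near=> n; rewrite /= sqr_ge0/=.
    have h1 : (f x + 1) * 1 ^+ n <= 2 ^+ n by near: n; apply: expr_dominated; rewrite ?ltr1n.
    have h2 : r n x <= 2^-1 ^+ n by apply: fgn; rewrite expr1n in h1; lra.
    have h3 : 2^-1 ^+ n <= 1 :> R by apply: exprn_ile1; lra.
    have h4 : 0 <= r n x by rewrite subr_ge0.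
    by nra.
  - exact: cvg_cst.
  - by apply: cvg_expr; rewrite ger0_norm// invf_lt1// ltr1n.
have mr n : measurable_fun setT (fun x => (r n x ^+ 2)%:E).
  by apply/measurable_EFinP/measurable_funX; exact: L2_measurable (r2 n).
have rf n x : (`|(r n x ^+ 2)%:E| <= (f x * f x)%:E)%E.
  rewrite gee0_abs lee_fin ?sqr_ge0// -expr2 ler_pXn2r ?nnegrE ?subr_ge0//.
  by rewrite gerBl.
have [_ _] := @dominated_convergence _ _ _ mu _ measurableT
  (fun n x => (r n x ^+ 2)%:E) (cst 0%:E) (fun x => (f x * f x)%:E)
  mr (measurable_cst _) (aeW _ (fun x _ => cvg0 x)) (L2_mul_integrable mu f2 f2)
  (aeW _ (fun x n _ => rf n x)).
rewrite integral0 => /fine_cvgP[_ /cvgrPdist_le/(_ e e0)[n _ /(_ n (leqnn n))]].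
rewrite /= inner_EFin//= sub0r normrN ger0_norm ?inner_ge0// => hn.
exists (D n), (n + n)%N, (2 ^- n); split=> //.
exact: gf.
Unshelve. all: by end_near. Qed.
End DyadicApproximation.

(** * The covariance form of a Markov contraction: from indicators to all of $L^2$ *)

Section CovarianceForm.
Context {d : measure_display} {T : measurableType d} {R : realType}
  (mu : probability T R).
Implicit Types (f g h : T -> R) (K : (T -> R) -> T -> R) (A B : set T).

(** Collects what the estimates below use about the powers $P^n$; linearity of the form will come
    from the adjoint. *)
Record markov_contraction K : Prop := {
  mc_L2 : forall f, L2 mu f -> L2 mu (K f);
  mc_norm : forall f, L2 mu f -> inner mu (K f) (K f) <= inner mu f f;
  mc_integral : forall f, L2 mu f -> \int[mu]_x K f x = \int[mu]_x f x;
  mc_unit_interval : forall f, measurable_fun setT f ->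
    (forall x, 0 <= f x <= 1) -> forall x, 0 <= K f x <= 1;
  mc_one : forall x, K (cst 1) x = 1;
  mc_adjoint : exists Kstar, is_adjoint mu K Kstar }.

(** As a contraction [K] preserves integrals, this is the covariance of [K f] and [K g]. Subtracting
    the means allows arguments outside $L^2_0$, such as indicators and positive parts, while on
    $L^2_0$ the form is just $\langle Kf, Kg\rangle$. *)
Definition cov K f g : R :=
  inner mu (K f) (K g) - (\int[mu]_x f x) * (\int[mu]_x g x).

Lemma covC K f g : cov K f g = cov K g f.
Proof. by rewrite /cov innerC mulrC. Qed.

Context K (hK : markov_contraction K).

(* [K] itself is only linear almost everywhere, but moving it to the other side
   makes the form linear on the nose. *)
Lemma mc_innerDl {f g h} : L2 mu f -> L2 mu g -> L2 mu h ->
  inner mu (K (fun x => f x + g x)) (K h) =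
  inner mu (K f) (K h) + inner mu (K g) (K h).
Proof.
have [Ks [Ks2 adj]] := mc_adjoint _ hK; have K2 := mc_L2 _ hK.
move=> f2 g2 h2; rewrite !adj ?innerDl//; do ?[exact: K2|exact: L2D].
by apply: Ks2; exact: K2.
Qed.

Lemma mc_innerZl a {f h} : L2 mu f -> L2 mu h ->
  inner mu (K (fun x => a * f x)) (K h) = a * inner mu (K f) (K h).
Proof.
have [Ks [Ks2 adj]] := mc_adjoint _ hK; have K2 := mc_L2 _ hK.
move=> f2 h2; rewrite !adj ?innerZl//; do ?[exact: K2|exact: L2Z].
by apply: Ks2; exact: K2.
Qed.

Lemma covDl {f g h} : L2 mu f -> L2 mu g -> L2 mu h ->
  cov K (fun x => f x + g x) h = cov K f h + cov K g h.
Proof.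
move=> f2 g2 h2; rewrite /cov mc_innerDl// RintegralD//; try exact: L2_integrable.
by ring.
Qed.

Lemma covZl a {f h} : L2 mu f -> L2 mu h ->
  cov K (fun x => a * f x) h = a * cov K f h.
Proof.
move=> f2 h2; rewrite /cov mc_innerZl// RintegralZl//; last exact: L2_integrable.
by ring.
Qed.

Lemma cov_suml (I : Type) (r : seq I) (F : I -> T -> R) g :
    (forall i, L2 mu (F i)) -> L2 mu g ->
  cov K (fun x => \sum_(i <- r) F i x) g = \sum_(i <- r) cov K (F i) g.
Proof.
move=> F2 g2; elim: r => [|i r IH].
  under eq_fun do rewrite big_nil -(mul0r 0).
  by rewrite (covZl 0 (L2_cst mu 0) g2) mul0r big_nil.
under eq_fun do rewrite big_cons.
by rewrite covDl ?IH ?big_cons//; exact: L2_sum.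
Qed.

Lemma cov_ge0 f : L2 mu f -> 0 <= cov K f f.
Proof.
move=> f2; rewrite subr_ge0 -expr2 -(mc_integral _ hK _ f2).
by apply: sqr_Rintegral_le; exact: mc_L2.
Qed.

Lemma cov_le f : L2 mu f -> cov K f f <= inner mu f f.
Proof.
move=> f2; rewrite (le_trans _ (mc_norm _ hK _ f2))// gerBl -expr2.
exact: sqr_ge0.
Qed.

Lemma cov_sqrDZ a {f g} : L2 mu f -> L2 mu g ->
  cov K (fun x => f x + a * g x) (fun x => f x + a * g x) =
  cov K f f + 2 * a * cov K f g + a ^+ 2 * cov K g g.
Proof.
move=> f2 g2; have ag2 := L2Z mu a g2; have h2 := L2D mu f2 ag2.
rewrite covDl// covZl// !(covC _ _ (fun x => _ + _)) !covDl// !covZl//.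
by rewrite (covC _ g f); ring.
Qed.

(** Positivity of the form at [f - g]. *)
Lemma cov_le_mean {f g} : L2 mu f -> L2 mu g ->
  cov K f g <= (cov K f f + cov K g g) / 2.
Proof.
move=> f2 g2; have := cov_ge0 _ (L2D mu f2 (L2Z mu (- 1) g2)).
by rewrite cov_sqrDZ//; nra.
Qed.

(** Parallelogram law, with the nonnegative term at [f - g] dropped. *)
Lemma cov_sqrD_le {f g} : L2 mu f -> L2 mu g ->
  cov K (fun x => f x + g x) (fun x => f x + g x) <= 2 * (cov K f f + cov K g g).
Proof.
move=> f2 g2; have -> : (fun x => f x + g x) = (fun x => f x + 1 * g x).
  by apply/funext => x; rewrite mul1r.
have := cov_ge0 _ (L2D mu f2 (L2Z mu (- 1) g2)).
by rewrite !cov_sqrDZ//; nra.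
Qed.

(** Since [K \1_A >= 0] and [K \1_B <= 1], the inner product is at most the integral of [K \1_A],
    which is [mu A]; the product of the means only helps. *)
Lemma cov_indic_le A B : measurable A -> measurable B ->
  cov K \1_A \1_B <= fine (mu A).
Proof.
move=> mA mB; have A2 := L2_indic mu mA; have B2 := L2_indic mu mB.
have K01 C x : measurable C -> 0 <= K \1_C x <= 1.
  move=> mC; apply: (mc_unit_interval _ hK); first exact: measurable_indic.
  by move=> y; rewrite indicE; case: (_ \in _); rewrite ?lexx ler01.
rewrite /cov; apply: (@le_trans _ _ (inner mu (K \1_A) (cst 1))).
  rewrite -[leRHS]subr0 lerB//.
    apply: le_inner; do ?[exact: mc_L2|exact: L2_cst] => x.
    have /andP[a0 _] := K01 A x mA; have /andP[_ b1] := K01 B x mB.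
    by rewrite /= ler_wpM2l.
  by rewrite mulr_ge0// Rintegral_ge0.
by rewrite inner1r mc_integral// Rintegral_indic.
Qed.

(** A Schur-type test: expand the form over pairs of levels [e i], [e j], bound each by a weight
    depending on the distance times the squared norms, and sum the weights along rows. *)
Lemma cov_dyadic_sum_le s N D m : 0 <= s ->
    (forall A, measurable A -> cov K \1_A \1_A <= s * fine (mu A)) ->
    (forall j, measurable (D j)) ->
  cov K (dyadic_sum D m) (dyadic_sum D m) <=
    2 * (N%:R * s + 4 * 2^-1 ^+ N) * inner mu (dyadic_sum D m) (dyadic_sum D m).
Proof.
move=> s0 hs mD; set f := dyadic_sum D m; have f2 : L2 mu f by exact: L2_dyadic_sum.
pose e j x : R := 2 ^+ j * \1_(D j) x.
have i2 j : L2 mu (\1_(D j) : T -> R) by exact: L2_indic.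
have e2 j : L2 mu (e j) by exact: L2Z.
have e0 j x : 0 <= e j x by rewrite mulr_ge0// exprn_ge0.
have p0 j : 0 <= 2 ^+ j :> R by rewrite exprn_ge0.
have xE j : inner mu (e j) (e j) = (2 ^+ j) ^+ 2 * fine (mu (D j)).
  by rewrite innerZl// innerC innerZl// inner_indic// expr2 mulrA.
have covE i j : cov K (e i) (e j) = 2 ^+ i * 2 ^+ j * cov K \1_(D i) \1_(D j).
  by rewrite covZl// covC covZl// covC mulrA.
(* The measure of the higher level's set is used: $2^{i+j} 2^j \mu(D_{i+j})$ is $2^{-i}$ times the
   squared norm of [e (i + j)]. *)
have far i j : cov K (e (i + j)%N) (e j) <= 2^-1 ^+ i * inner mu (e (i + j)%N) (e (i + j)%N).
  rewrite covE xE exprD mulrA; apply: (@le_trans _ _ (2 ^+ i * 2 ^+ j * 2 ^+ j * fine (mu (D (i + j)%N)))).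
    by rewrite ler_wpM2l ?cov_indic_le// !mulr_ge0.
  rewrite le_eqVlt; apply/orP; left; apply/eqP; rewrite exprVn; field.
  by rewrite expf_neq0.
pose w := dyadic_weight N s.
have w0 k : 0 <= w k by exact: dyadic_weight_ge0.
have near i j : cov K (e i) (e j) <=
    w ((i - j) + (j - i))%N * (inner mu (e i) (e i) + inner mu (e j) (e j)).
  wlog ij : i j / (j <= i)%N => [hw|].
    have [ji|/ltnW ij] := leqP j i; first exact: hw.
    by rewrite covC addnC [X in _ * X]addrC; exact: hw.
  rewrite (eqP (ij : j - i == 0)%N) addn0 /w /dyadic_weight.
  case: ifPn => [_|hN].
    have hjj k : cov K (e k) (e k) <= s * inner mu (e k) (e k).
      by rewrite covE xE mulrCA -expr2 ler_wpM2l ?hs// sqr_ge0.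
    have := hjj i; have := hjj j; have := cov_le_mean (e2 i) (e2 j); lra.
  have := far (i - j)%N j; rewrite subnK// => /le_trans; apply.
  by rewrite ler_wpM2l ?exprn_ge0// lerDl inner_ge0.
have fE : f = (fun x => \sum_(0 <= j < m) e j x) by [].
set W := N%:R * (s / 2) + 2 * 2^-1 ^+ N.
have hW i : (i < m)%N -> \sum_(0 <= j < m) w ((i - j) + (j - i))%N <= 2 * W.
  by apply: sum_distn_le => // n; exact: sum_dyadic_weight_le.
have W0 : 0 <= W by rewrite addr_ge0// mulr_ge0// ?divr_ge0// exprn_ge0.
(* All [e j] are nonnegative, so pointwise [e i <= f] and each diagonal term is dominated by
   $\langle e_i, f\rangle$. *)
have xf : \sum_(0 <= i < m) inner mu (e i) (e i) <= inner mu f f.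
  rewrite {1}fE inner_suml// big_nat_cond [leRHS]big_nat_cond ler_sum// => i /andP[/andP[_ im] _].
  apply: le_inner => // x; apply: ler_wpM2l => //.
  rewrite fE (bigD1_seq i) ?iota_uniq ?mem_index_iota//= lerDl.
  by rewrite sumr_ge0.
have -> : 2 * (N%:R * s + 4 * 2^-1 ^+ N) = 4 * W by rewrite /W; field.
apply: le_trans (ler_wpM2l _ xf); last by rewrite mulr_ge0.
have -> : cov K f f = \sum_(0 <= i < m) \sum_(0 <= j < m) cov K (e i) (e j).
  rewrite {1}fE cov_suml//; apply: eq_bigr => i _.
  by rewrite covC fE cov_suml//; apply: eq_bigr => j _; rewrite covC.
pose x i := inner mu (e i) (e i).
apply: (@le_trans _ _ (\sum_(0 <= i < m) \sum_(0 <= j < m)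
   (w ((i - j) + (j - i))%N * x i + w ((j - i) + (i - j))%N * x j))).
  apply: ler_sum => i _; apply: ler_sum => j _.
  by rewrite [X in w X * x j]addnC -mulrDr.
under eq_bigr do rewrite big_split/=.
(* Exchanging the summations identifies the two halves; each is at most [2 * W] times the sum of the
   squared norms, which explains [4 * W]. *)
rewrite big_split/= [X in _ + X]exchange_big/= -[leLHS]mulr2n -[leLHS]mulr_natl.
have -> : 4 * W = 2 * (2 * W) by ring.
rewrite -mulrA ler_wpM2l// mulr_sumr big_nat_cond [leRHS]big_nat_cond.
apply: ler_sum => i /andP[/andP[_ im] _]; rewrite -mulr_suml.
by rewrite ler_wpM2r ?hW// inner_ge0.
Qed.

(** Approximate [f] from below by a scaled dyadic sum [g]. Splitting [f = g + (f - g)] doubles the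
    constant, and the remainder contributes at most twice [e / 2] because the form is bounded by the
    squared norm. *)
Lemma cov_nonneg_le s N f : 0 <= s ->
    (forall A, measurable A -> cov K \1_A \1_A <= s * fine (mu A)) ->
    L2 mu f -> (forall x, 0 <= f x) ->
  cov K f f <= 4 * (N%:R * s + 4 * 2^-1 ^+ N) * inner mu f f.
Proof.
move=> s0 hs f2 f0; apply/ler_addgt0Pr => e e0.
have [D [m [a [mD a0 gf fg]]]] := dyadic_approximation mu f (e / 2) f2 f0 (divr_gt0 e0 (ltr0n _ 2)).
have D2 : L2 mu (dyadic_sum D m) by exact: L2_dyadic_sum.
pose g x := a * dyadic_sum D m x; have g2 : L2 mu g by exact: L2Z.
have r2 : L2 mu (fun x => f x - g x) by exact: L2B.
have gg : inner mu g g <= inner mu f f.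
  apply: le_inner => // x; have g0 : 0 <= g x by rewrite mulr_ge0// dyadic_sum_ge0.
  by apply: ler_pM => //; exact: gf.
have covg : cov K g g <= 2 * (N%:R * s + 4 * 2^-1 ^+ N) * inner mu g g.
  have aa : 0 <= a ^+ 2 by exact: sqr_ge0.
  have := ler_wpM2l aa (cov_dyadic_sum_le s N D m s0 hs mD).
  rewrite /g covZl// covC covZl// innerZl// innerC innerZl//; set X := inner _ _ _.
  by rewrite mulrA -expr2; move/le_trans; apply; rewrite le_eqVlt; apply/orP; left; apply/eqP; ring.
have hN : 0 <= 2^-1 ^+ N :> R by rewrite exprn_ge0.
have c0 : 0 <= 2 * (N%:R * s + 4 * 2^-1 ^+ N) by rewrite mulr_ge0// addr_ge0// mulr_ge0.
have := le_trans covg (ler_wpM2l c0 gg).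
have := le_trans (cov_le _ r2) fg.
have := cov_sqrD_le g2 r2.
have -> : (fun x => g x + (f x - g x)) = f by apply/funext => x; rewrite addrC subrK.
set X := inner _ _ _; set Y := N%:R * s + _; lra.
Qed.

(** Positive and negative parts are orthogonal, so their squared norms add up, while splitting the
    form costs another factor 2. The constant is then $8(Ns + 4\cdot 2^{-N}) \le 32(Ns +
    2^{-N})$. *)
Lemma cov_le_log s N f : 0 <= s ->
    (forall A, measurable A -> cov K \1_A \1_A <= s * fine (mu A)) ->
    L2 mu f -> cov K f f <= 32 * (N%:R * s + 2^-1 ^+ N) * inner mu f f.
Proof.
move=> s0 hs f2; have mf := L2_measurable mu f2.
pose fp x := Num.max (f x) 0; pose fn x := Num.max (- f x) 0.
have fp2 : L2 mu fp.
  apply: (L2_le mu _ f2); first by apply: measurable_maxr.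
  by move=> x; rewrite /fp; case: (leP (f x) 0); rewrite ?normr0.
have fn2 : L2 mu fn.
  apply: (L2_le mu _ f2).
    by apply: measurable_maxr => //; exact: measurableT_comp.
  by move=> x; rewrite /fn; case: (leP (- f x) 0); rewrite ?normr0 ?normrN.
have fpn x : fp x = f x /\ fn x = 0 \/ fp x = 0 /\ fn x = - f x.
  rewrite /fp /fn; have [fx|fx] := lerP 0 (f x).
    by left; split=> //; rewrite max_r// oppr_le0.
  by right; split=> //; rewrite max_l// oppr_ge0 ltW.
have fE : f = (fun x => fp x + (- 1) * fn x).
  by apply/funext => x; have [[-> ->]|[-> ->]] := fpn x; lra.
have -> : inner mu f f = inner mu fp fp + inner mu fn fn.
  rewrite {1 2}fE inner_sqrDZ//.
  have -> : inner mu fp fn = 0.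
    rewrite /inner (_ : (fun x => _) = cst 0) ?Rintegral_cst ?mul0r//.
    by apply/funext => x; have [[-> ->]|[-> ->]] := fpn x; rewrite ?mulr0 ?mul0r.
  by ring.
have covf : cov K f f <= 2 * (cov K fp fp + cov K fn fn).
  rewrite {1 2}fE; apply: le_trans (cov_sqrD_le fp2 (L2Z mu (- 1) fn2)) _.
  have n2 := L2Z mu (- 1) fn2.
  by rewrite (covZl (- 1) fn2 n2) covC (covZl (- 1) fn2 fn2); lra.
have fp0 x : 0 <= fp x by rewrite /fp le_max lexx orbT.
have fn0 x : 0 <= fn x by rewrite /fn le_max lexx orbT.
have hN : 0 <= 2^-1 ^+ N :> R by rewrite exprn_ge0.
have Ns : 0 <= N%:R * s by rewrite mulr_ge0.
have := cov_nonneg_le s N fp s0 hs fp2 fp0; have := cov_nonneg_le s N fn s0 hs fn2 fn0.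
have := inner_ge0 mu fp; have := inner_ge0 mu fn.
move: covf hN Ns; set X := inner _ _ _; set Y := inner _ _ _.
by set Z := N%:R * s; set V := _ ^+ N; nra.
Qed.
End CovarianceForm.

(** * The Markov operator of a kernel with invariant probability measure, acting on $L^2$ *)

Section MarkovOperator.
Context {d : measure_display} {T : measurableType d} {R : realType}.
Context (p : R.-pker T ~> T) (mu : probability T R)
  (inv : Defs.invariant p mu).
Implicit Types (f : T -> R).
Local Open Scope ereal_scope.

Lemma integral_invariant (f : T -> \bar R) : (forall x, 0 <= f x) ->
  measurable_fun setT f -> \int[mu]_x \int[p x]_y f y = \int[mu]_x f x.
Proof.
move=> f0 mf.
(* [mu] is viewed as a constant kernel from the one-point space, so that the iterated integral
   becomes one against a composition of kernels; by invariance that composition is [mu] again. *)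
pose l := kprobability (measurable_cst (mu : pprobability T R) : measurable_fun [set: unit] _).
rewrite -[LHS](integral_kcomp l (kernel.kernel_snd (T0 := unit) p) tt f0 mf).
by apply: eq_measure_integral => A mA _; rewrite /= -inv.
Qed.

Local Close Scope ereal_scope.

Lemma kernel_setT (x : T) : p x [set: T] = 1%E :> \bar R.
Proof. exact: prob_kernel. Qed.

(** A copy of [p x] that carries a probability structure, so that the $L^2$ lemmas apply to each
    transition law. *)
Definition kernel_probability (x : T) : set T -> \bar R := p x.

HB.instance Definition _ (x : T) := Measure.on (kernel_probability x).

HB.instance Definition _ (x : T) := Measure_isProbability.Build _ _ _
  (kernel_probability x) (kernel_setT x).

Lemma Rintegral_kernel_probability (x : T) f :
  \int[kernel_probability x]_y f y = \int[p x]_y f y.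
Proof. by congr fine; exact: eq_measure_integral. Qed.

Lemma measurable_kernel_integral (g : T -> \bar R) : (forall y, 0 <= g y)%E ->
  measurable_fun setT g -> measurable_fun setT (fun x : T => \int[p x]_y g y)%E.
Proof.
by move=> g0 mg; apply: measurable_fun_integral_kernel => // U mU; exact: measurable_kernel.
Qed.

Lemma measurable_markov_op f : measurable_fun setT f ->
  measurable_fun setT (markov_op p f).
Proof.
move=> mf; apply: (measurableT_comp (f := fine)) => //.
have mE : measurable_fun setT (EFin \o f) by exact/measurable_EFinP.
under eq_fun do rewrite integralE.
by apply: emeasurable_funB; apply: measurable_kernel_integral => //;
  [exact: measurable_funepos|exact: measurable_funeneg].
Qed.

Lemma markov_op_cst (a : R) (x : T) : markov_op p (cst a) x = a.
Proof. by rewrite /markov_op Rintegral_cst// kernel_setT mulr1. Qed.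

Lemma markov_op_unit_interval f : measurable_fun setT f ->
  (forall x, 0 <= f x <= 1) -> forall x, 0 <= markov_op p f x <= 1.
Proof.
move=> mf f01 x; apply/andP; split.
  by apply: Rintegral_ge0 => y _; case/andP: (f01 y).
rewrite -[leRHS](markov_op_cst 1 x) /markov_op -!Rintegral_kernel_probability.
have f2 : L2 (kernel_probability x) f.
  apply: (L2_bounded _ 1) => // y; have /andP[f0 f1] := f01 y.
  by rewrite ger0_norm.
apply: le_Rintegral => //; do ?exact: L2_integrable.
  by apply: L2_integrable; exact: L2_cst.
by move=> y _; case/andP: (f01 y).
Qed.

(* When [f ^ 2] is not [p x]-integrable the left-hand side is a junk value but
   the right-hand side is infinite. *)
Lemma sqr_markov_op_le f (x : T) : measurable_fun setT f ->
  ((markov_op p f x ^+ 2)%:E <= \int[p x]_y (f y ^+ 2)%:E)%E.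
Proof.
move=> mf; have [fin|] := boolP (\int[p x]_y (f y ^+ 2)%:E < +oo)%E; last first.
  by rewrite -leNgt leye_eq => /eqP ->; rewrite leey.
have eqi g : (\int[p x]_y g y = \int[kernel_probability x]_y g y)%E.
  exact: eq_measure_integral.
have f2 : L2 (kernel_probability x) f by apply/L2P; rewrite -eqi.
rewrite eqi inner_EFin// lee_fin /markov_op -Rintegral_kernel_probability.
exact: sqr_Rintegral_le.
Qed.

(** Integrate the pointwise Jensen inequality against [mu] and use invariance on $f^2$. *)
Lemma L2_markov_op f : L2 mu f -> L2 mu (markov_op p f) /\
  inner mu (markov_op p f) (markov_op p f) <= inner mu f f.
Proof.
move=> f2; have mf := L2_measurable mu f2; have mPf := measurable_markov_op f mf.
have h : (\int[mu]_x (markov_op p f x ^+ 2)%:E <= \int[mu]_x (f x ^+ 2)%:E)%E.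
  have mf2 : measurable_fun setT (fun x => (f x ^+ 2)%:E).
    by apply/measurable_EFinP; exact: measurable_funX.
  have f20 x : (0 <= (f x ^+ 2)%:E)%E by rewrite lee_fin sqr_ge0.
  rewrite -(integral_invariant _ f20 mf2).
  apply: ge0_le_integral => //.
  - by move=> x _; rewrite lee_fin sqr_ge0.
  - by apply/measurable_EFinP; exact: measurable_funX.
  - by apply: measurable_fun_integral_kernel => // U mU; exact: measurable_kernel.
  - by move=> x _; exact: sqr_markov_op_le.
have Pf2 : L2 mu (markov_op p f).
  by apply/L2P; split=> //; apply: le_lt_trans h _; have /L2P[] := f2.
by split=> //; move: h; rewrite !inner_EFin// lee_fin.
Qed.

(** By invariance the kernel integrals [Ep] and [En] of the positive and negative parts are
    [mu]-integrable, with the same integrals as those parts. *)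
Lemma Rintegral_markov_op f : L2 mu f ->
  \int[mu]_x markov_op p f x = \int[mu]_x f x.
Proof.
move=> f2; have fi := L2_integrable mu f2; have mf := L2_measurable mu f2.
congr fine; pose g := EFin \o f.
have mg : measurable_fun setT g by exact/measurable_EFinP.
pose Ep (x : T) := (\int[p x]_y g^\+ y)%E; pose En (x : T) := (\int[p x]_y g^\- y)%E.
have ip : mu.-integrable setT Ep.
  apply/integrableP; split; first by apply: measurable_kernel_integral => //; exact: measurable_funepos.
  under eq_integral do rewrite gee0_abs ?integral_ge0//.
  rewrite integral_invariant//; last exact: measurable_funepos.
  have /integrableP[_] := integrable_funepos measurableT fi.
  by under eq_integral do rewrite gee0_abs//.
have iN : mu.-integrable setT En.
  apply/integrableP; split; first by apply: measurable_kernel_integral => //; exact: measurable_funeneg.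
  under eq_integral do rewrite gee0_abs ?integral_ge0//.
  rewrite integral_invariant//; last exact: measurable_funeneg.
  have /integrableP[_] := integrable_funeneg measurableT fi.
  by under eq_integral do rewrite gee0_abs//.
transitivity (\int[mu]_x (Ep x - En x))%E.
  apply: ae_eq_integral => //.
  - by apply/measurable_EFinP; exact: measurable_markov_op.
  - by apply: emeasurable_funB; [exact: measurable_int ip|exact: measurable_int iN].
  - have := integrable_ae measurableT ip; have := integrable_ae measurableT iN.
    (* Where both parts are finite, [fine] takes no default value and [markov_op p f x] really is
       [Ep x - En x]. *)
    apply: filterS2 => x fn fp _; rewrite /markov_op /Rintegral fineK integralE//.
    by rewrite fin_numB fp// fn.
rewrite integralB// !integral_invariant//; first by rewrite -integralE.
  exact: measurable_funeneg.
exact: measurable_funepos.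
Qed.
End MarkovOperator.

(** * Norms of the powers on $L^2_0$ compared with the constants $k_{P^{*n}P^n}$ *)

Section SpectralGap.
Context {d : measure_display} {T : measurableType d} {R : realType}.
Context (p : R.-pker T ~> T) (mu : probability T R)
  (inv : Defs.invariant p mu).
Context (Pstar : (T -> R) -> T -> R)
  (adj : is_adjoint mu (markov_op p) Pstar).
Implicit Types (f : T -> R) (n : nat) (c : R) (A : set T).

Notation P := (markov_op p).

Lemma L2_iter_markov_op n f : L2 mu f -> L2 mu (iter n P f).
Proof. by move=> f2; elim: n => //= n /(L2_markov_op p mu inv)[]. Qed.

Lemma L20_iter_markov_op n f : L20 mu f -> L20 mu (iter n P f).
Proof.
move=> f20; elim: n => //= n [Pf2 Pf0]; split; first by case: (L2_markov_op p mu inv _ Pf2).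
by rewrite Rintegral_markov_op.
Qed.

Lemma is_adjoint_iter n : is_adjoint mu (iter n P) (iter n Pstar).
Proof.
have [Ps2 adjE] := adj; split=> [f f2|f g f2].
  by elim: n => //= n; exact: Ps2.
elim: n g => //= n IH g g2; rewrite adjE//; last exact: L2_iter_markov_op.
by rewrite IH ?iterS -?iterSr//; exact: Ps2.
Qed.

Lemma markov_contraction_iter n : markov_contraction mu (iter n P).
Proof.
split.
- exact: L2_iter_markov_op.
- move=> f f2; elim: n => //= n IH; apply: le_trans IH.
  by have [] := L2_markov_op p mu inv _ (L2_iter_markov_op n f f2).
- move=> f f2; elim: n => //= n IH.
  by rewrite Rintegral_markov_op//; exact: L2_iter_markov_op.
- move=> f mf f01; suff [] : measurable_fun setT (iter n P f) /\
    forall x, 0 <= iter n P f x <= 1 by [].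
  elim: n => //= n [mPf Pf01]; split; first exact: measurable_markov_op.
  exact: markov_op_unit_interval.
- elim: n => //= n IH x; have -> : iter n P (cst 1) = cst 1 by apply/funext.
  exact: markov_op_cst.
- by exists (iter n Pstar); exact: is_adjoint_iter.
Qed.

Definition contraction_bound n c : Prop :=
  0 <= c /\ forall f, L20 mu f ->
    inner mu (iter n P f) (iter n P f) <= c * inner mu f f.

(** The squared operator norm $\|P^n\|^2$ on $L^2_0$. *)
Definition sqr_norm_iter n : R := inf [set c | contraction_bound n c].

Lemma contraction_bound1 n : contraction_bound n 1.
Proof.
by split=> // f [f2 _]; rewrite mul1r; exact: mc_norm (markov_contraction_iter n) _ f2.
Qed.

Lemma has_inf_contraction_bound n : has_inf [set c | contraction_bound n c].
Proof. by split; [exists 1; exact: contraction_bound1|exists 0 => c []]. Qed.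

Lemma sqr_norm_iter_le n c : contraction_bound n c -> sqr_norm_iter n <= c.
Proof. by move=> hc; apply: (ge_inf (has_inf_contraction_bound n).2). Qed.

(** The infimum is attained: for fixed [f] of positive norm, the quotient of the squared norms is a
    lower bound of all admissible constants. For [f] of norm zero, the bound with constant 1
    suffices. *)
Lemma contraction_bound_sqr_norm_iter n : contraction_bound n (sqr_norm_iter n).
Proof.
have [ne _] := has_inf_contraction_bound n; split; first by apply: lb_le_inf => // c [].
move=> f f20; have := inner_ge0 mu f; rewrite le_eqVlt => /predU1P[f0|f0].
  have := (contraction_bound1 n).2 f f20; by rewrite -f0 !mulr0.
rewrite -ler_pdivrMr//; apply: lb_le_inf => // c [c0 hc].
by rewrite ler_pdivrMr// hc.
Qed.

Lemma sqr_norm_iterD m n :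
  sqr_norm_iter (m + n) <= sqr_norm_iter m * sqr_norm_iter n.
Proof.
have [m0 hm] := contraction_bound_sqr_norm_iter m.
have [n0 hn] := contraction_bound_sqr_norm_iter n.
apply: sqr_norm_iter_le; split=> [|f f20]; first exact: mulr_ge0.
rewrite iterD (le_trans (hm _ (L20_iter_markov_op _ _ f20)))// -mulrA.
by rewrite ler_wpM2l// hn.
Qed.

(** Move $P^{*n}$ across the inner product, write the indicator of the complement as $1 - 1_A$ and
    use $P^n 1 = 1$. This ties the integral defining [kset] to the covariance form. *)
Lemma cov_indicE n A : measurable A ->
  \int[mu]_(x in A) iter n Pstar (iter n P \1_(~` A)) x =
  fine (mu A) * fine (mu (~` A)) - cov mu (iter n P) \1_A \1_A.
Proof.
move=> mA; have hK := markov_contraction_iter n.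
have A2 := L2_indic mu mA; have o2 := L2_cst mu 1.
have -> : \int[mu]_(x in A) iter n Pstar (iter n P \1_(~` A)) x =
    inner mu \1_A (iter n Pstar (iter n P \1_(~` A))).
  rewrite Rintegral_mkcond; apply: eq_Rintegral => x _.
  by rewrite /patch indicE; case: ifP; rewrite ?mul1r ?mul0r.
rewrite -(is_adjoint_iter n).2//; last exact: mc_L2 hK _ (L2_indic mu (measurableC mA)).
have -> : \1_(~` A) = (fun x => cst 1 x + (- 1) * \1_A x) :> (T -> R).
  apply/funext => x; rewrite !indicE in_setC.
  by case: (x \in A); rewrite /= ?mulr1 ?mulr0 ?subrr ?addr0.
rewrite innerC (mc_innerDl mu _ hK o2 (L2Z mu (- 1) A2) A2) (mc_innerZl mu _ hK _ A2 A2) /cov.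
have -> : iter n P (cst 1) = cst 1 by apply/funext => x; exact: mc_one hK x.
rewrite innerC inner1r mc_integral// Rintegral_indic//.
by rewrite probability_setC// fineB ?fin_num_measure//=; ring.
Qed.

(** Test the bound on the centred indicator [h]: it lies in $L^2_0$, has squared norm
    $\mu(A)\mu(A^c)$, and the form ignores the added constant. *)
Lemma cov_indic_contraction n c A : contraction_bound n c -> measurable A ->
  cov mu (iter n P) \1_A \1_A <= c * (fine (mu A) * fine (mu (~` A))).
Proof.
move=> [c0 hc] mA; have hK := markov_contraction_iter n; set K := iter n P.
have A2 := L2_indic mu mA; have o2 := L2_cst mu 1.
pose a := fine (mu A); pose h x : R := \1_A x + (- a) * cst 1 x.
have h2 : L2 mu h by apply: L2D => //; exact: L2Z.
have h0 : \int[mu]_x h x = 0.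
  rewrite RintegralD ?RintegralZl//; do ?by apply: L2_integrable => //; exact: L2Z.
  by rewrite Rintegral_indic// Rintegral_cst1 -/a; ring.
have K1 : K (cst 1) = cst 1 by apply/funext => x; exact: mc_one hK x.
have covh : cov mu K h h = cov mu K \1_A \1_A.
  rewrite (cov_sqrDZ mu K hK _ A2 o2) /cov K1 !inner1r Rintegral_cst1.
  by rewrite mc_integral//; ring.
have hh : inner mu h h = a * fine (mu (~` A)).
  rewrite inner_sqrDZ// inner_indic// !inner1r Rintegral_cst1 Rintegral_indic//.
  by rewrite probability_setC// fineB ?fin_num_measure//= -/a; ring.
rewrite -covh -hh; have := hc h (conj h2 h0).
by rewrite /cov h0 mulr0 subr0.
Qed.

Let Q n f := iter n Pstar (iter n P f).

Lemma nontrivial_fine_gt0 A : nontrivial_set mu A ->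
  0 < fine (mu A) * fine (mu (~` A)).
Proof.
move=> [mA /andP[A0 A1]]; rewrite probability_setC// fineB ?fin_num_measure//=.
have Ale : fine (mu A) < 1 by rewrite -lte_fin fineK// fin_num_measure.
have A0' : 0 < fine (mu A) by rewrite -lte_fin fineK// fin_num_measure.
by rewrite mulr_gt0// subr_gt0.
Qed.

Lemma cov_indic_kset n A : nontrivial_set mu A ->
  cov mu (iter n P) \1_A \1_A =
  (1 - kset mu (Q n) A) * (fine (mu A) * fine (mu (~` A))).
Proof.
move=> nA; have A0 := nontrivial_fine_gt0 A nA; have [mA _] := nA.
by rewrite /kset cov_indicE// mulrBl mul1r mulrAC mulVf ?gt_eqF// mul1r; ring.
Qed.

Lemma kset_ge n c A : contraction_bound n c -> nontrivial_set mu A ->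
  1 - c <= kset mu (Q n) A.
Proof.
move=> hc nA; have A0 := nontrivial_fine_gt0 A nA; have [mA _] := nA.
have := cov_indic_contraction n c A hc mA.
by rewrite cov_indic_kset// ler_pM2r// => h; lra.
Qed.

Lemma kset_le1 n A : nontrivial_set mu A -> kset mu (Q n) A <= 1.
Proof.
move=> nA; have A0 := nontrivial_fine_gt0 A nA; have [mA _] := nA.
have := cov_ge0 mu _ (markov_contraction_iter n) _ (L2_indic mu mA).
by rewrite cov_indic_kset// pmulr_lge0// subr_ge0.
Qed.

Lemma kinf_le_kset n A : nontrivial_set mu A -> kinf mu (Q n) <= kset mu (Q n) A.
Proof.
move=> nA; apply: ge_inf; last by exists A.
by exists (1 - 1) => _ [B nB <-]; apply: kset_ge nB; exact: contraction_bound1.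
Qed.

(** Both bounds on [kset] pass to the infimum; the given nontrivial set ensures that this infimum is
    over a nonempty set and not a default value. *)
Lemma kinf_bounds n : (exists A, nontrivial_set mu A) ->
  0 <= 1 - kinf mu (Q n) <= sqr_norm_iter n.
Proof.
move=> [A nA]; apply/andP; split.
  by rewrite subr_ge0 (le_trans (kinf_le_kset n A nA))// kset_le1.
rewrite lerBlDr -lerBlDl; apply: lb_le_inf; first by exists (kset mu (Q n) A), A.
move=> _ [B nB <-]; apply: kset_ge nB; exact: contraction_bound_sqr_norm_iter.
Qed.

Lemma cov_indic_kinf n A : (exists A, nontrivial_set mu A) -> measurable A ->
  cov mu (iter n P) \1_A \1_A <= (1 - kinf mu (Q n)) * fine (mu A).
Proof.
move=> hA mA; have /andP[S0 _] := kinf_bounds n hA.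
have a0 : 0 <= fine (mu A) by exact: fine_ge0.
have [nA|tA] := pselect (nontrivial_set mu A).
  rewrite cov_indic_kset//; have := kinf_le_kset n A nA.
  have := nontrivial_fine_gt0 A nA; have := kset_le1 n A nA.
  rewrite probability_setC// fineB ?fin_num_measure//=; nra.
apply: (@le_trans _ _ 0); last exact: mulr_ge0.
have := cov_indic_contraction n 1 A (contraction_bound1 n) mA.
rewrite mul1r probability_setC// fineB ?fin_num_measure//= => /le_trans; apply.
have : ~~ (0 < mu A < 1)%E by apply/negP => h; exact: tA.
rewrite negb_and -!leNgt => /orP[h|h].
  by have /eqP -> : mu A == 0%E; [rewrite eq_le h measure_ge0|rewrite mul0r].
by have /eqP -> : mu A == 1%E; [rewrite eq_le h probability_le1|rewrite subrr mulr0].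
Qed.

(** On $L^2_0$ the form equals $\|P^n f\|^2$, so the logarithmic estimate with $s = 1 -
    k_{P^{*n}P^n}$ bounds the operator norm. *)
Lemma sqr_norm_iter_le_kinf n N : (exists A, nontrivial_set mu A) ->
  sqr_norm_iter n <= 32 * (N%:R * (1 - kinf mu (Q n)) + 2^-1 ^+ N).
Proof.
move=> hA; have /andP[S0 _] := kinf_bounds n hA.
apply: sqr_norm_iter_le; split.
  by rewrite mulr_ge0// addr_ge0// ?mulr_ge0// exprn_ge0.
move=> f [f2 f0]; have := cov_le_log mu _ (markov_contraction_iter n) _ N f S0 _ f2.
rewrite /cov f0 mulr0 subr0; apply => A mA; exact: cov_indic_kinf.
Qed.
End SpectralGap.

(** * From the decay of the operator norms to the decay of each orbit *)

Theorem theorem3 (d : measure_display) (T : measurableType d) (R : realType)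
    (p : R.-pker T ~> T) (pi : probability T R)
    (hF : countably_generated T)
    (hpi : positive_recurrent p pi)
    (hA : exists A, nontrivial_set pi A)
    (Pstar : (T -> R) -> (T -> R))
    (hPstar : is_adjoint pi (markov_op p) Pstar)
    (q : R)
    (hq : positive_quasi_selfadjoint_generated pi
            (fun n f => iter n Pstar (iter n (markov_op p) f)) q) :
  let k n := kinf pi (fun f => iter n Pstar (iter n (markov_op p) f)) in
  let rho n := Num.sqrt (1 - k n) `^ n%:R^-1 in
  cvgn rho /\
  forall f, L20 pi f ->
    (limn_esup (fun n => norm2 pi (iter n (markov_op p) f) `^ n%:R^-1)
       <= (Num.max (limn rho) q)%:E)%E.
Proof.
move=> k rho; have [_ _ inv _] := hpi.
pose L := sqr_norm_iter p pi.
have L01 n : 0 <= L n <= 1.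
  have [L0 _] := contraction_bound_sqr_norm_iter p pi inv Pstar hPstar n.
  by rewrite L0 (sqr_norm_iter_le p pi inv Pstar hPstar)//; exact: (contraction_bound1 p pi inv Pstar hPstar).
have [r [r0 rho_r Lr]] := cvg_root_of_log_comparable L (fun n => 1 - k n) 32
  L01 (sqr_norm_iterD p pi inv Pstar hPstar) (fun n => kinf_bounds p pi inv Pstar hPstar n hA)
  (ler0n _ _) (fun n N => sqr_norm_iter_le_kinf p pi inv Pstar hPstar n N hA).
split; first by apply/cvg_ex; exists r.
move=> f f20; have -> : limn rho = r by exact: cvg_lim rho_r.
apply: (@le_trans _ _ r%:E); last by rewrite lee_fin le_max lexx.
apply/lee_addgt0Pr => e e0; rewrite -EFinD.
(* Half of [e] is kept in reserve, so that passing to base [r + e] absorbs both [C] and the squared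
   norm of [f]. *)
have [C hC] := Lr (r + e / 2) ltac:(lra).
have le2 : 0 <= (r + e / 2) ^+ 2 < (r + e) ^+ 2.
  by rewrite sqr_ge0 ltr_pXn2r ?nnegrE//; lra.
have [le2_0 le2_lt] := andP le2.
(* The upper limit is an infimum of suprema over eventual sets, so it is enough to exhibit one such
   set: the [n] at which the root is at most [r + e]. *)
apply: ereal_inf_le.
exists (ereal_sup [set norm2 pi (iter n (markov_op p) f) `^ n%:R^-1 | n in
  [set n : nat | norm2 pi (iter n (markov_op p) f) `^ n%:R^-1 <= (r + e)%:E]])%E.
  eexists; last by [].
  near=> n; rewrite /=; have n0 : (0 < n)%N by near: n; exists 1%N.
  have fn20 := L20_iter_markov_op p pi inv n f f20.
  rewrite norm2E; last by case: fn20.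
  rewrite poweR_EFin lee_fin powR_invn_le ?sqrtr_ge0//; last lra.
  rewrite -[leRHS]ger0_norm ?exprn_ge0//; last lra.
  rewrite -sqrtr_sqr; apply: ler_wsqrtr; rewrite -exprM mulnC exprM.
  have [_ hL] := contraction_bound_sqr_norm_iter p pi inv Pstar hPstar n.
  apply: le_trans (hL f f20) _.
  apply: le_trans (ler_wpM2r (inner_ge0 pi f) (hC n)) _.
  by rewrite mulrAC; near: n; exact: expr_dominated.
by apply: ge_ereal_sup => _ [n /= hn <-].
Unshelve. all: by end_near. Qed.
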